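(* Let $Y=[y_L,y_U]$ be a random interval with $\mathbf E(|y_L|+|y_U|)<\infty$. Let $\alpha\in(0,1)$ and $q_\alpha\in[T_Y^{-1}(\alpha),C_Y^{-1}(\alpha)]$. Then $\Theta_E(\alpha,q_\alpha)$ is a convex subset of $\mathbb R$, hence an interval (possibly degenerate) contained in $[\mathbf E y_L,\mathbf E y_U]$. Equivalently, for any $y^{(1)},y^{(2)}\in\mathbf{Sel}_\alpha(Y\mid q_\alpha)$ and any $\theta\in[0,1]$ there exists $\tilde y\in\mathbf{Sel}_\alpha(Y\mid q_\alpha)$ such that $$\mathbf E[\tilde y]=\theta\,\mathbf E[y^{(1)}]+(1-\theta)\,\mathbf E[y^{(2)}].$$
   Context: $(\Omega,\mathcal A,\mathbf P)$ is a complete non-atomic probability space. A random interval is $Y(\omega)=[y_L(\omega),y_U(\omega)]\subset\mathbb R$ with $y_L,y_U$ measurable real-valued and $\mathbf P(y_L\le y_U)=1$. $\mathbf{Sel}(Y)$ is the set of measurable $y:\Omega\to\mathbb R$ with $y(\omega)\in Y(\omega)$ a.s. $T_Y((-\infty,t]):=\mathbf P(Y\cap(-\infty,t]\ne\emptyset)$, $C_Y((-\infty,t]):=\mathbf P(Y\subseteq(-\infty,t])$, $T_Y^{-1}(\alpha):=\inf\{t:T_Y((-\infty,t])\ge\alpha\}$, $C_Y^{-1}(\alpha):=\inf\{t:C_Y((-\infty,t])\ge\alpha\}$. With $F_y(t)=\mathbf P(y\le t)$ and $F_y^{-1}(\alpha)=\inf\{t:F_y(t)\ge\alpha\}$, put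 $\mathbf{Sel}_\alpha(Y\mid q_\alpha):=\{y\in\mathbf{Sel}(Y):F_y^{-1}(\alpha)=q_\alpha\}$ and $\Theta_E(\alpha,q_\alpha):=\{\mathbf E[y]:y\in\mathbf{Sel}_\alpha(Y\mid q_\alpha)\}$. *)

(* Defs.v *)
From HB Require Import structures.
From mathcomp Require Import all_boot all_order all_algebra.
From mathcomp Require Import all_classical all_reals all_analysis.

Set Implicit Arguments.
Unset Strict Implicit.
Unset Printing Implicit Defensive.

Import Order.TTheory GRing.Theory Num.Theory.
Import numFieldNormedType.Exports.

Local Open Scope classical_set_scope.
Local Open Scope ring_scope.

Definition nonatomic d (T : measurableType d) (R : realType)
    (P : probability T R) : Prop :=
  forall A : set T, measurable A -> (0 < P A)%E ->
  exists B : set T, [/\ measurable B, B `<=` A & (0 < P B < P A)%E].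

Record random_interval d (T : measurableType d) (R : realType)
    (P : probability T R) := RandomInterval {
  lower : {RV P >-> R} ;
  upper : {RV P >-> R} ;
  lower_le_upper : P [set w | lower w <= upper w] = 1%E }.

(* Y(w); empty on the null event where the endpoints are out of order. *)
Definition realization d (T : measurableType d) (R : realType)
    (P : probability T R) (Y : random_interval P) (w : T) : set R :=
  `[lower Y w, upper Y w].

Definition Sel d (T : measurableType d) (R : realType)
    (P : probability T R) (Y : random_interval P) : set {RV P >-> R} :=
  [set y : {RV P >-> R} | {ae P, forall w, realization Y w (y w)}].

(* T_Y((-oo, t]) *)
Definition capacity d (T : measurableType d) (R : realType)
    (P : probability T R) (Y : random_interval P) (t : R) : \bar R :=
  P [set w | realization Y w `&` `]-oo, t] !=set0].

(* C_Y((-oo, t]) *)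
Definition containment d (T : measurableType d) (R : realType)
    (P : probability T R) (Y : random_interval P) (t : R) : \bar R :=
  P [set w | realization Y w `<=` `]-oo, t]].

(* The infimum is taken in R, where inf is 0 on sets that are empty or not
   bounded below; neither occurs for the functions used here if 0 < a < 1. *)
Definition ginv (R : realType) (F : R -> \bar R) (a : R) : R :=
  inf [set t | (a%:E <= F t)%E].

Definition Sel_quantile d (T : measurableType d) (R : realType)
    (P : probability T R) (Y : random_interval P) (a q : R) :
    set {RV P >-> R} :=
  [set y : {RV P >-> R} | Sel Y y /\ ginv (cdf y) a = q].

(* 'E_P is extended-real valued; when the endpoints of Y are integrable, every
   selection is integrable, so the equation discards no selection. *)
Definition Theta_E d (T : measurableType d) (R : realType)
    (P : probability T R) (Y : random_interval P) (a q : R) : set R :=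
  [set x : R | exists2 y : {RV P >-> R},
    Sel_quantile Y a q y & ('E_P[y] = x%:E)%E].

(* Main.v *)
Require Import Defs.
From mathcomp Require Import all_boot all_order all_algebra.
From mathcomp Require Import all_classical all_reals all_analysis.
From mathcomp Require Import measurable_realfun lra ring.

(** Why the statement holds.  Fix two admissible selections y1, y2 and a weight
    0 < s < 1.  For any event K, the function equal to y1 on K and to y2 off K
    is again a selection of Y, so everything comes down to choosing K.  A
    convexity theorem of Lyapunov type says that on a non-atomic space an event
    K can be found which takes exactly the share s of finitely many absolutely
    continuous additive set functions at once.  Applied to the integrals of y1
    and y2 and to the masses of {yi <= q} and {yi < q}, it gives the mixture
    the mean s E[y1] + (1 - s) E[y2], and makes its masses on {<= q} and on
    {< q} the same convex combinations.

    The a-quantile of y is q exactly when P(y <= q) >= a and P(y <= t) < a for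
    every t < q ([ginv_cdfP]).  The first condition passes to the mixture at
    once.  So does P(y < q) <= a, but this bound is weaker than the second
    condition: if P(y < q) = a, one still needs some mass of y in ]t, q[ for
    every t < q.  If P(y1 < q) < a, then P(y < q) < a.  Otherwise every event
    {t < y1 < q} has positive mass, and it is enough that K meets all of them
    in positive mass.  These events are nested, so of the two halves of a set
    meeting all of them, one still does; halving repeatedly gives a piece of
    share at most s which meets them all, and K is obtained by enlarging this
    piece ([halvable_share_meeting]).

    The Lyapunov-type theorem is proved by adding the set functions one at a
    time.  If every event can be halved simultaneously for a class N, dyadic
    subdivision yields an increasing chain (C s), 0 <= s <= 1, of shares s for N
    ([halvable_chain]).  For one more set function nu, the number
    nu (C (c + 1/2)) - nu (C c) depends continuously on c, and its values at
    c = 0 and c = 1/2 add up to nu A; by the intermediate value theorem it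
    equals nu A / 2 for some c, and then C (c + 1/2) minus C c halves A for nu
    and for N alike ([halvable_setU1]).  The induction starts from P itself,
    which can be halved because it has no atoms ([nonatomic_halvable]). *)

Set Implicit Arguments.
Unset Strict Implicit.
Unset Printing Implicit Defensive.

Import Order.TTheory GRing.Theory Num.Theory.
Import numFieldNormedType.Exports.

Local Open Scope classical_set_scope.
Local Open Scope ring_scope.

(** * Dyadic approximation of reals *)

Section dyadic.
Context {R : realType}.
Implicit Types s : R.

Lemma exists_geometric_lt (c e : R) : 0 < e -> exists n, c * 2^-1 ^+ n < e.
Proof.
move=> e0; have : geometric c (2^-1) n @[n --> \oo] --> 0.
  by apply: cvg_geometric; rewrite ger0_norm// invf_lt1// ltr1n.
move/cvgrPdist_lt => /(_ e e0)[n _ nP]; exists n.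
have := nP n (leqnn n); rewrite /= sub0r normrN.
exact: le_lt_trans (ler_norm _).
Qed.

Lemma half_truncn_dyadic n s : 0 <= s ->
  (Num.truncn (s * 2 ^+ n.+1))./2 = Num.truncn (s * 2 ^+ n).
Proof.
move=> s0; apply/esym/eqP.
have sn : 0 <= s * 2 ^+ n by rewrite mulr_ge0// exprn_ge0.
rewrite truncn_eq//.
have := truncn_itv (mulr_ge0 (ler0n _ 2) sn : 0 <= 2 * (s * 2 ^+ n)).
rewrite mulrCA -exprS; set k := Num.truncn _ => /andP[k1 k2].
have sE : s * 2 ^+ n.+1 = 2 * (s * 2 ^+ n) by rewrite exprS; ring.
rewrite sE in k1 k2.
have kE : k%:R = (odd k)%:R + 2 * k./2%:R :> R.
  by rewrite -{1}(odd_double_half k) natrD -muln2 natrM mulrC.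
have : (odd k)%:R <= 1 :> R by case: (odd k).
have : 0 <= (odd k)%:R :> R by [].
move: k1 k2; rewrite -!natr1 kE => *; apply/andP; split; lra.
Qed.

Lemma cvg_truncn_dyadic s : 0 <= s ->
  (Num.truncn (s * 2 ^+ n))%:R / 2 ^+ n @[n --> \oo] --> s.
Proof.
move=> s0; apply/cvgrPdist_lt => e e0.
have : geometric 1 (2^-1 : R) n @[n --> \oo] --> 0.
  by apply: cvg_geometric; rewrite ger0_norm// invf_lt1// ltr1n.
move/cvgrPdist_lt => /(_ e e0); apply: filterS => n.
rewrite /= sub0r normrN mul1r exprVn ger0_norm ?invr_ge0 ?exprn_ge0//.
apply: le_lt_trans.
have p0 : 0 < 2 ^+ n :> R by rewrite exprn_gt0.
have := truncn_itv (mulr_ge0 s0 (ltW p0)); set k := Num.truncn _ => /andP[k1 k2].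
rewrite ger0_norm; last by rewrite subr_ge0 ler_pdivrMr.
by rewrite lerBlDl -[X in _ + X]mul1r -mulrDl ler_pdivlMr// natr1 ltW.
Qed.

End dyadic.

(** * Absolutely continuous set functions and non-atomicity *)

Section set_functions.
Context {d : measure_display} {T : measurableType d} {R : realType}.
Variable P : probability T R.
Implicit Types (A B : set T) (nu : set T -> R).

Definition pr A : R := fine (P A).

(** Real-valued, finitely additive and absolutely continuous with respect to P:
    this is all that the halving argument needs, and it covers signed integrals
    and masses of traces uniformly. *)
Definition ac_additive nu :=
  (forall A B, measurable A -> measurable B -> A `&` B = set0 ->
     nu (A `|` B) = nu A + nu B) /\
  (forall e, 0 < e -> exists2 dl, 0 < dl &
     forall A, measurable A -> pr A < dl -> `|nu A| < e).

Lemma prE A : measurable A -> P A = (pr A)%:E.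
Proof. by move=> mA; rewrite fineK// fin_num_measure. Qed.

Lemma pr_ge0 A : 0 <= pr A.
Proof. exact: fine_ge0. Qed.

Lemma pr_setU A B : measurable A -> measurable B -> A `&` B = set0 ->
  pr (A `|` B) = pr A + pr B.
Proof.
by move=> mA mB AB; rewrite /pr measureU// fineD// fin_num_measure.
Qed.

Lemma pr_ac : ac_additive pr.
Proof.
split=> [|e e0]; first exact: pr_setU.
by exists e => // A mA; rewrite ger0_norm ?pr_ge0.
Qed.

Lemma ac_setD nu A B : ac_additive nu -> measurable A -> measurable B ->
  B `<=` A -> nu (A `\` B) = nu A - nu B.
Proof.
move=> [nuU _] mA mB BA; rewrite -{2}(setDUK BA) nuU ?setDIK//.
  by rewrite addrC addKr.
exact: measurableD.
Qed.

Lemma ac_null nu A : ac_additive nu -> measurable A -> pr A = 0 -> nu A = 0.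
Proof.
move=> [_ nuc] mA A0; apply/eqP; rewrite -normr_eq0 eq_le normr_ge0 andbT.
apply/ler_addgt0Pr => e /nuc[dl dl0 /(_ A mA)]; rewrite A0 add0r => /(_ dl0).
exact: ltW.
Qed.

Lemma ac_set0 nu : ac_additive nu -> nu set0 = 0.
Proof. by move=> nuac; rewrite (ac_null nuac)// /pr measure0. Qed.

Lemma le_pr A B : measurable A -> measurable B -> A `<=` B -> pr A <= pr B.
Proof.
move=> mA mB AB; rewrite -subr_ge0 -(ac_setD pr_ac)//; exact: pr_ge0.
Qed.

Lemma pr_le1 A : measurable A -> pr A <= 1.
Proof. by move=> mA; rewrite -lee_fin -prE// probability_le1. Qed.

(** Absolute continuity turns the continuity of P from below into that of nu, so
    no countable additivity has to be assumed. *)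
Lemma ac_cvg_bigcup nu (F : (set T)^nat) : ac_additive nu ->
  (forall n, measurable (F n)) -> nondecreasing_seq F ->
  nu (F n) @[n --> \oo] --> nu (\bigcup_n F n).
Proof.
move=> nuac mF ndF.
have mU : measurable (\bigcup_n F n) by exact: bigcup_measurable.
have FU n : F n `<=` \bigcup_n F n by move=> w Fw; exists n.
have : pr (F n) @[n --> \oo] --> pr (\bigcup_n F n).
  suff /fine_cvgP[//] : (P (F n) @[n --> \oo] --> (pr (\bigcup_n F n))%:E)%E.
  by rewrite -prE//; exact: nondecreasing_cvg_mu.
move/cvgrPdist_lt => prF; apply/cvgrPdist_lt => e e0.
have [dl dl0 nudl] := nuac.2 e e0.
near=> n; rewrite -ac_setD//; apply: nudl; first exact: measurableD.
rewrite (ac_setD pr_ac)//; apply: le_lt_trans (ler_norm _) _.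
by near: n; exact: prF.
Unshelve. all: by end_near. Qed.

(** Starting from A0, pick supersets in F whose probability comes within
    1 / (n + 1) of the best possible; the union of the picks cannot be enlarged
    within F in measure. *)
Lemma exhaustion (F : set (set T)) A0 : F A0 -> F `<=` measurable ->
  (forall B : (set T)^nat, nondecreasing_seq B -> (forall n, F (B n)) ->
     F (\bigcup_n B n)) ->
  exists2 B, F B & forall C, F C -> B `<=` C -> pr C = pr B.
Proof.
move=> FA0 mF FU.
pose S B := [set pr C | C in [set C | F C /\ B `<=` C]].
have /choice[h hP] : forall nB : nat * set T, exists C' : set T, F nB.2 ->
    [/\ F C', nB.2 `<=` C' &
      forall C, F C -> nB.2 `<=` C -> pr C < pr C' + nB.1.+1%:R^-1].
  move=> [n B] /=; have [FB|] := pselect (F B); last by exists set0.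
  have supS : has_sup (S B).
    split; first by exists (pr B); exists B; [split=> //; exact: subset_refl|].
    by exists 1 => _ [C [FC _] <-]; rewrite pr_le1//; exact: mF.
  have n0 : 0 < n.+1%:R^-1 :> R by rewrite invr_gt0 ltr0n.
  have [_ [C' [FC' BC'] <-] supC'] := sup_adherent n0 supS.
  exists C' => _; split=> // C FC BC; rewrite -ltrBlDr.
  rewrite (le_lt_trans _ supC')// lerB//; apply: ub_le_sup; first exact: supS.2.
  by exists C.
pose B := fix B n := if n is m.+1 then h (m, B m) else A0.
have FB n : F (B n) by elim: n => //= n /(hP (n, B n))[].
have ndB : nondecreasing_seq B.
  by apply/nondecreasing_seqP => n; apply/subsetPset; have [] := hP (n, B n) (FB n).
exists (\bigcup_n B n) => [|C FC BC]; first exact: FU.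
have mB := mF _ (FU _ ndB FB).
have mC : measurable C := mF _ FC.
apply/eqP; rewrite eq_le [X in _ && X]le_pr// andbT.
apply/ler_addgt0Pr => e e0.
have [n ne] : exists n : nat, n.+1%:R^-1 < e.
  by have [n _ nP] := near_infty_natSinv_lt (PosNum e0); exists n; exact: (nP n (leqnn n)).
have [_ _ /(_ C FC)] := hP (n, B n) (FB n).
have BnC : B n `<=` C by apply: subset_trans BC => w Bw; exists n.
move=> /(_ BnC) /ltW /le_trans; apply; apply: lerD; last exact: ltW.
apply: le_pr => //; first exact: mF _ (FB n.+1).
by move=> w Bw; exists n.+1.
Qed.

(** The half must be common to all members of N; this simultaneity is what makes
    the property an induction hypothesis for Lyapunov's theorem. *)
Definition halvable (N : set (set T -> R)) :=
  forall A, measurable A ->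
  exists B, [/\ measurable B, B `<=` A & forall nu, N nu -> nu B = nu A / 2].

(** A set of positive probability splits into two parts of positive probability,
    one of which has at most half of it; iterate. *)
Lemma small_subset A e : nonatomic P -> measurable A -> 0 < pr A -> 0 < e ->
  exists B, [/\ measurable B, B `<=` A & 0 < pr B < e].
Proof.
move=> na mA A0 e0.
have halve B : measurable B -> 0 < pr B ->
    exists C, [/\ measurable C, C `<=` B & 0 < pr C <= pr B / 2].
  move=> mB B0; have PB0 : (0 < P B)%E by rewrite prE.
  have [C [mC CB]] := na _ mB PB0.
  rewrite !prE// !lte_fin => /andP[C0 CltB].
  have [CB2|BC2] := leP (pr C) (pr B / 2); first by exists C; rewrite C0 CB2.
  exists (B `\` C); rewrite (ac_setD pr_ac)//.
  split; [exact: measurableD|exact: subDsetl|]; lra.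
have [n] := exists_geometric_lt (pr A) e0; rewrite exprVn => ne.
suff [B [mB BA /andP[B0 Bn]]] : exists B,
    [/\ measurable B, B `<=` A & 0 < pr B <= pr A / 2 ^+ n].
  by exists B; split => //; rewrite B0 (le_lt_trans Bn).
elim: n {ne} => [|n [B [mB BA /andP[B0 Bn]]]].
  by exists A; rewrite expr0 divr1 A0 lexx; split=> //; exact: subset_refl.
have [C [mC CB /andP[C0 Cn]]] := halve _ mB B0.
exists C; split=> //; first exact: subset_trans BA.
by rewrite C0 (le_trans Cn)// exprSr invfM mulrA ler_pM2r ?invr_gt0 ?ltr0n.
Qed.

(** Among the subsets of A of probability at most P(A)/2 take one that cannot be
    enlarged; if it fell short of P(A)/2, a small piece of its complement in A
    could be added to it. *)
Lemma nonatomic_halvable : nonatomic P -> halvable [set pr].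
Proof.
move=> na A mA.
pose F := [set B | [/\ measurable B, B `<=` A & pr B <= pr A / 2]].
have [| | |B [mB BA Bh] Bmax] := @exhaustion F set0.
- by split=> //; rewrite (ac_set0 pr_ac) divr_ge0// pr_ge0.
- by move=> B [].
- move=> B ndB FB; split.
  + by apply: bigcup_measurable => n _; have [] := FB n.
  + by move=> w [n _ Bw]; have [_ + _] := FB n; exact.
  + have mB n : measurable (B n) by have [] := FB n.
    apply: (cvgr_to_le (ac_cvg_bigcup pr_ac mB ndB)).
    by near=> n; have [] := FB n.
exists B; split => // _ ->.
apply/eqP; rewrite eq_le Bh leNgt; apply/negP => Blt.
have [|||C [mC CD /andP[C0 Ch]]] := @small_subset (A `\` B) (pr A / 2 - pr B) na.
- exact: measurableD.
- rewrite (ac_setD pr_ac)//; have := pr_ge0 B; lra.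
- by rewrite subr_gt0.
have BC0 : B `&` C = set0.
  by apply/seteqP; split=> // w [Bw /CD[]].
have BCE : pr (B `|` C) = pr B + pr C by exact: pr_setU.
have : pr (B `|` C) = pr B.
  apply: Bmax; last exact: subsetUl.
  split; [exact: measurableU|by move=> w [/BA//|/CD[]]|rewrite BCE; lra].
rewrite BCE; lra.
Unshelve. all: by end_near. Qed.

End set_functions.

(** * Simultaneous halving and chains of proportional sets *)

Section chains.
Context {d : measure_display} {T : measurableType d} {R : realType}.
Variable P : probability T R.
Implicit Types (A B : set T) (nu : set T -> R) (N : set (set T -> R)).

(** For k <= 2 ^ n this is the set of share k / 2 ^ n at dyadic level n: level
    n.+1 keeps the sets of level n and inserts a new one between neighbours, by
    adding half, as chosen by h, of their difference. *)
Fixpoint dyadic_stage (h : set T -> set T) A n k : set T :=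
  if n is m.+1 then
    let B := dyadic_stage h A m k./2 in
    if odd k then B `|` h (dyadic_stage h A m k./2.+1 `\` B) else B
  else if k is 0 then set0 else A.

Lemma dyadic_stage_double h A n k :
  dyadic_stage h A n.+1 k.*2 = dyadic_stage h A n k.
Proof. by rewrite /= odd_double doubleK. Qed.

Lemma dyadic_stage_doubleS h A n k :
  dyadic_stage h A n.+1 k.*2.+1 =
  dyadic_stage h A n k `|`
    h (dyadic_stage h A n k.+1 `\` dyadic_stage h A n k).
Proof. by rewrite /= odd_double uphalf_double. Qed.

(** The dyadic truncations of s approach s from below, so the corresponding
    stages increase. *)
Definition chain (h : set T -> set T) A (s : R) : set T :=
  \bigcup_n dyadic_stage h A n (Num.truncn (s * 2 ^+ n)).

Section halving.
Variables (N : set (set T -> R)) (h : set T -> set T) (A : set T).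
Hypothesis N_ac : forall nu, N nu -> ac_additive P nu.
Hypothesis h_half : forall B, measurable B ->
  [/\ measurable (h B), h B `<=` B & forall nu, N nu -> nu (h B) = nu B / 2].
Hypothesis mA : measurable A.

Let D := dyadic_stage h A.

Lemma measurable_dyadic_stage n k : measurable (D n k).
Proof.
elim: n k => [[|k]|n IH k]; rewrite /D //=.
case: (odd k); last exact: IH.
apply: measurableU; first exact: IH.
by have [] := h_half (measurableD (IH k./2.+1) (IH k./2)).
Qed.
Let mD := measurable_dyadic_stage.

Lemma dyadic_stageS n k : D n k `<=` D n k.+1.
Proof.
elim: n k => [[|k] w //|n IH k].
rewrite -[k]odd_double_half; case: (odd k); rewrite ?add0n ?add1n.
  rewrite -doubleS /D dyadic_stage_doubleS dyadic_stage_double.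
  move=> w [/IH//|]; have [_ + _] := h_half (measurableD (mD n k./2.+1) (mD n k./2)).
  by move=> /[apply] -[].
rewrite /D dyadic_stage_doubleS dyadic_stage_double; exact: subsetUl.
Qed.

Lemma le_dyadic_stage n k l : (k <= l)%N -> D n k `<=` D n l.
Proof.
by move/subnK <-; elim: (l - k)%N => // m IH; apply: subset_trans (@dyadic_stageS _ _).
Qed.

Lemma dyadic_stage_sub n k : D n k `<=` A.
Proof.
elim: n k => [[|k] w //|n IH k]; rewrite /D /=.
case: (odd k); last exact: IH.
move=> w [/IH//|].
have [_ + _] := h_half (measurableD (mD n k./2.+1) (mD n k./2)).
by move=> /[apply] -[/IH].
Qed.

Lemma dyadic_stageE nu n k : N nu -> (k <= 2 ^ n)%N ->
  nu (D n k) = k%:R / 2 ^+ n * nu A.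
Proof.
move=> Nnu; have nuac := N_ac Nnu.
elim: n k => [|n IH k].
  case=> [|[|//]] _; first by rewrite (ac_set0 nuac) mul0r mul0r.
  by rewrite expr0 divr1 mul1r.
have p0 : 2 ^+ n != 0 :> R by rewrite expf_neq0.
rewrite -[k]odd_double_half; case: (odd k); rewrite ?add0n ?add1n => kn.
  have kn' : (k./2 < 2 ^ n)%N by rewrite -ltn_double -[(2 ^ n).*2]mul2n -expnS.
  rewrite /D dyadic_stage_doubleS -!/(D n _).
  have mDD := measurableD (mD n k./2.+1) (mD n k./2).
  have [mh hs /(_ _ Nnu) hE] := h_half mDD.
  rewrite nuac.1//; last by apply/seteqP; split=> // w [Dw /hs[]].
  rewrite hE (ac_setD nuac)//; last exact: dyadic_stageS.
  rewrite !IH// ?(ltnW kn')// exprS -!natr1 -muln2 natrM.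
  by field.
rewrite /D dyadic_stage_double -/(D n _) IH; last first.
  by rewrite -leq_double -[(2 ^ n).*2]mul2n -expnS.
rewrite exprS -muln2 natrM; by field.
Qed.

Lemma chainE s : 0 <= s <= 1 -> [/\ measurable (chain h A s),
  chain h A s `<=` A & forall nu, N nu -> nu (chain h A s) = s * nu A].
Proof.
move=> /andP[s0 s1]; split.
- by apply: bigcup_measurable => n _; exact: mD.
- by move=> w [n _]; exact: dyadic_stage_sub.
- move=> nu Nnu.
  pose k n := Num.truncn (s * 2 ^+ n).
  have cvgU : nu (D n (k n)) @[n --> \oo] --> nu (chain h A s).
    apply: (ac_cvg_bigcup (N_ac Nnu)) => [n|]; first exact: mD.
    apply/nondecreasing_seqP => n; apply/subsetPset.
    rewrite {1}/k -half_truncn_dyadic// -/(k _).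
    rewrite -[k n.+1 in X in _ `<=` X]odd_double_half; case: (odd (k n.+1)).
      by rewrite /D dyadic_stage_doubleS; exact: subsetUl.
    by rewrite /D dyadic_stage_double; exact: subset_refl.
  apply: (cvg_unique (@Rhausdorff R) cvgU).
  rewrite (_ : (fun n => _) = fun n => (k n)%:R / 2 ^+ n * nu A).
    by apply: cvgMl; exact: cvg_truncn_dyadic.
  apply/funext => n; rewrite dyadic_stageE// /k truncn_le_nat -[(2 ^ n).+1%:R]natr1 natrX.
  by rewrite ltr_pwDr// ler_piMl// exprn_ge0.
Qed.

Lemma le_chain r s : 0 <= r -> r <= s -> chain h A r `<=` chain h A s.
Proof.
move=> r0 rs w [n _ Dw]; exists n => //; apply: le_dyadic_stage Dw.
by apply: le_truncn; rewrite ler_wpM2r// exprn_ge0.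
Qed.

End halving.

(** Shares of every size s come from halves, as limits of the dyadic ones. *)
Lemma halvable_chain N A : (forall nu, N nu -> ac_additive P nu) ->
  halvable N -> measurable A -> exists C : R -> set T,
  (forall s, 0 <= s <= 1 -> [/\ measurable (C s), C s `<=` A &
     forall nu, N nu -> nu (C s) = s * nu A]) /\
  (forall r s, 0 <= r -> r <= s -> C r `<=` C s).
Proof.
move=> Nac halfN mA.
have /choice[h hP] : forall B, exists B', measurable B ->
    [/\ measurable B', B' `<=` B & forall nu, N nu -> nu B' = nu B / 2].
  move=> B; have [mB|] := pselect (measurable B); last by exists set0.
  by have [B' ?] := halfN B mB; exists B'.
exists (chain h A); split=> [s s01|r s r0 rs]; first exact: chainE.
exact: (le_chain hP).
Qed.

(** The induction step of Lyapunov's theorem.  Sets C (c + 1/2) minus C c are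
    halves of A for all of N whatever c is, and c is tuned to halve nu. *)
Lemma halvable_setU1 N nu : (forall mu, N mu -> ac_additive P mu) ->
  N (pr P) -> ac_additive P nu -> halvable N -> halvable (nu |` N).
Proof.
move=> Nac Npr nuac halfN A mA.
have [C [CP ndC]] := halvable_chain Nac halfN mA.
(* The chain is controlled on [0, 1] only; clamping its parameter makes g below
   continuous on the whole line. *)
pose clamp (s : R) := Num.max 0 (Num.min s 1).
have clampP (s : R) : [\/ s <= 0 /\ clamp s = 0, 0 <= s <= 1 /\ clamp s = s |
    1 <= s /\ clamp s = 1].
  rewrite /clamp; case: (leP 1 s) => s1; first by apply: Or33; rewrite max_r.
  case: (leP 0 s) => s0; first by apply: Or32; rewrite (ltW s1).
  by apply: Or31; rewrite (ltW s0).
have clamp01 (s : R) : 0 <= clamp s <= 1.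
  by case: (clampP s) => -[h ->]; rewrite ?lexx ?ler01.
have clampE (s : R) : 0 <= s <= 1 -> clamp s = s.
  by move=> h; case: (clampP s) => -[h' E]; lra.
pose g s := nu (C (clamp s)).
have mC s : measurable (C (clamp s)) by have [] := CP _ (clamp01 s).
have prC s : pr P (C (clamp s)) = clamp s * pr P A.
  by have [_ _ /(_ _ Npr)] := CP _ (clamp01 s).
have ndC' (r s : R) : r <= s -> C (clamp r) `<=` C (clamp s).
  move=> rs; apply: ndC; first by case/andP: (clamp01 r).
  by case: (clampP r) => -[h ->]; case: (clampP s) => -[h' ->]; lra.
have clamp_lip (r s : R) : r <= s -> clamp s - clamp r <= s - r.
  by move=> rs; case: (clampP r) => -[h ->]; case: (clampP s) => -[h' ->]; lra.
have gc : continuous g.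
  move=> x; apply/cvgrPdist_lt => /= e e0.
  have [dl dl0 nudl] := nuac.2 e e0.
  have key (r s : R) : r <= s -> s - r < dl -> `|g s - g r| < e.
    move=> rs srd; rewrite /g -(ac_setD nuac)//; last exact: ndC'.
    apply: nudl; first exact: measurableD.
    rewrite (ac_setD (pr_ac P))//; last exact: ndC'.
    rewrite !prC -mulrBl (le_lt_trans _ srd)//.
    have := clamp_lip _ _ rs; have := pr_le1 P mA; have := pr_ge0 P A; nra.
  have : \forall y \near x, `|x - y| < dl by apply/nbhs_normP; exists dl.
  apply: filterS => y xyd; have [xy|yx] := leP x y.
    by rewrite distrC; apply: key; rewrite // -[ltLHS]ger0_norm ?subr_ge0// distrC.
  by apply: key; rewrite ?(ltW yx)// -[ltLHS]ger0_norm// subr_ge0 ltW.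
have m12 : 0 <= (2^-1 : R) <= 1 by rewrite invr_ge0 ler0n invf_le1 ?ltr0n// ler1n.
have m0 : 0 <= (0 : R) <= 1 by rewrite lexx ler01.
have m1 : 0 <= (1 : R) <= 1 by rewrite lexx ler01.
have C1A : C (clamp 1) `<=` A by have [_ + _] := CP _ (clamp01 1).
have g0 : g 0 = 0 by apply: (ac_null nuac) => //; rewrite prC clampE// mul0r.
have g1 : g 1 = nu A.
  apply/eqP; rewrite eq_sym -subr_eq0 /g -(ac_setD nuac)//.
  apply/eqP/(ac_null nuac); first exact: measurableD.
  rewrite (ac_setD (pr_ac P))// ?prC ?clampE ?mul1r ?subrr//.
(* phi 0 + phi (1/2) = nu A, so nu A / 2 lies between these two values. *)
pose phi s := g (s + 2^-1) - g s.
have phic : {within `[0, 2^-1], continuous phi}.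
  apply: continuous_subspaceT => x; apply: cvgB; last exact: gc.
  have : {for x, continuous (g \o (fun s : R => s + 2^-1))}.
    apply: continuous_comp; last exact: gc.
    by apply: cvgD; [exact: cvg_id|exact: cvg_cst].
  by apply.
have [||c c12 phic12] := @IVT R phi 0 2^-1 (nu A / 2) _ phic.
- by case/andP: m12.
- rewrite /phi add0r g0 subr0 (_ : 2^-1 + 2^-1 = 1 :> R) ?g1; last by lra.
  by rewrite ge_min le_max; case: (leP (g 2^-1) (nu A / 2)) => ?; apply/andP; split; apply/orP; lra.
have {c12} /andP[c0 c12] : 0 <= c <= 2^-1 by rewrite in_itv in c12.
have c01 : 0 <= c <= 1 by lra.
have d01 : 0 <= c + 2^-1 <= 1 by lra.
have [mCc CcA CcE] := CP _ c01; have [mCd CdA CdE] := CP _ d01.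
have cd : C c `<=` C (c + 2^-1) by apply: ndC => //; lra.
exists (C (c + 2^-1) `\` C c); split; first exact: measurableD.
  by move=> w [/CdA].
move=> mu [->|Nmu].
  by rewrite (ac_setD nuac)// -phic12 /phi /g !clampE.
by rewrite (ac_setD (Nac _ Nmu))// CcE// CdE//; lra.
Qed.

End chains.

(** * Proportional sets *)

Section shares.
Context {d : measure_display} {T : measurableType d} {R : realType}.
Variable P : probability T R.
Implicit Types (A B C K : set T) (nu : set T -> R) (N : set (set T -> R)).

Lemma ac_Rintegral (f : T -> R) : P.-integrable setT (EFin \o f) ->
  ac_additive P (fun A => \int[P]_(w in A) f w).
Proof.
move=> intf; split=> [A B mA mB AB|e e0].
  apply: Rintegral_setU => //; last exact/disj_set2P.
  by apply: integrableS intf => //; exact: measurableU.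
have [dl [dl0 fdl]] := integral_normr_continuous intf e0.
exists dl => // A mA Adl; have {}Adl : (P A < dl%:E)%E by rewrite prE.
apply: le_lt_trans (fdl A mA Adl).
by apply: le_normr_Rintegral => //; apply: integrableS intf.
Qed.

Lemma ac_prI B : measurable B -> ac_additive P (fun A => pr P (A `&` B)).
Proof.
move=> mB; split=> [A A' mA mA' AA'|e e0].
  rewrite setIUl pr_setU//; try exact: measurableI.
  by rewrite setIACA AA' set0I.
exists e => // A mA; apply: le_lt_trans; rewrite ger0_norm ?pr_ge0//.
by apply: le_pr => //; exact: measurableI.
Qed.

Lemma halvable_share N A (s : R) : (forall nu, N nu -> ac_additive P nu) ->
  halvable N -> measurable A -> 0 <= s <= 1 ->
  exists B, [/\ measurable B, B `<=` A & forall nu, N nu -> nu B = s * nu A].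
Proof.
move=> Nac halfN mA s01; have [C [CP _]] := halvable_chain Nac halfN mA.
by exists (C s); exact: CP.
Qed.

(** If one half of K misses some member C of the nested family F, it also misses
    every smaller member; the other half then meets those, hence every larger
    one too.  So meeting all of F survives halving. *)
Lemma halvable_share_meeting N (F : set (set T)) (s : R) :
  (forall nu, N nu -> ac_additive P nu) -> halvable N ->
  (forall C, F C -> measurable C /\ 0 < pr P C) ->
  (forall C C', F C -> F C' -> C `<=` C' \/ C' `<=` C) ->
  0 < s < 1 ->
  exists K, [/\ measurable K, forall nu, N nu -> nu K = s * nu setT &
    forall C, F C -> 0 < pr P (K `&` C)].
Proof.
move=> Nac halfN FP Ftot /andP[s0 s1].
have stage n : exists K, [/\ measurable K,
    forall nu, N nu -> nu K = 2^-1 ^+ n * nu setT &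
    forall C, F C -> 0 < pr P (K `&` C)].
  elim: n => [|n [K [mK KE KF]]].
    exists setT; split=> // [nu _|C /FP[mC C0]]; first by rewrite expr0 mul1r.
    by rewrite setTI.
  have [B [mB BK BE]] := halfN K mK.
  have [BF|/existsNP[C0 /not_implyP[FC0 /negP]]] :=
    pselect (forall C, F C -> 0 < pr P (B `&` C)).
    exists B; split=> // nu Nnu; rewrite BE// KE// exprS; by field.
  rewrite -leNgt => BC0.
  exists (K `\` B); split=> [|nu Nnu|C FC]; first exact: measurableD.
    rewrite (ac_setD (Nac _ Nnu))// BE// KE// exprS; by field.
  have [mC0 _] := FP _ FC0; have [mC _] := FP _ FC.
  have [C' [FC' C'C C'C0]] : exists C', [/\ F C', C' `<=` C & C' `<=` C0].
    by have [?|?] := Ftot _ _ FC FC0; [exists C|exists C0]; split.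
  have [mC' _] := FP _ FC'.
  have mKC' := measurableI _ _ mK mC'; have mBC' := measurableI _ _ mB mC'.
  have : pr P (B `&` C') <= 0.
    apply: le_trans BC0; apply: le_pr => //; first exact: measurableI.
    exact: setIS.
  have : 0 < pr P (K `&` C') by exact: KF.
  have BKC' : B `&` C' `<=` K `&` C' by exact: setSI.
  have : pr P ((K `&` C') `\` (B `&` C')) <= pr P ((K `\` B) `&` C).
    apply: le_pr; [exact: measurableD|by apply: measurableI => //; exact: measurableD|].
    by move=> w [[Kw C'w] nB]; split; [split=> // Bw; exact: nB|exact: C'C].
  rewrite (ac_setD (pr_ac P))//; lra.
have [n] := exists_geometric_lt 1 s0; rewrite mul1r => ns.
(* K meets all of F but has share r < s; it is completed inside its complement,
   of share 1 - r, by the missing share s - r. *)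
have [K [mK KE KF]] := stage n.
set r := 2^-1 ^+ n in ns KE.
have r0 : 0 <= r by rewrite exprn_ge0// invr_ge0.
have r1 : 0 < 1 - r by lra.
have [||B [mB BK BE]] := @halvable_share N (~` K) ((s - r) / (1 - r)) Nac halfN.
- exact: measurableC.
- by rewrite ler_pdivrMr// ler_pdivlMr// mul0r; apply/andP; split; lra.
exists (K `|` B); split=> [|nu Nnu|C FC]; first exact: measurableU.
  have nuac := Nac _ Nnu.
  rewrite nuac.1//; last by apply/seteqP; split=> // w [Kw /BK].
  rewrite BE// -setTD (ac_setD nuac)// KE//; field; lra.
have [mC _] := FP _ FC.
apply: lt_le_trans (KF _ FC) _; apply: le_pr; try exact: measurableI.
  by apply: measurableI => //; exact: measurableU.
by apply: setSI; exact: subsetUl.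
Qed.

End shares.

(** * Quantiles and mixtures of random variables *)

Section quantiles.
Context {d : measure_display} {T : measurableType d} {R : realType}.
Variable P : probability T R.
Implicit Types (y : {RV P >-> R}) (a q t : R).

Lemma measurable_RV_le y t : measurable [set w | y w <= t].
Proof.
rewrite (_ : [set _ | _] = y @^-1` `]-oo, t]); last first.
  by apply/seteqP; split=> w /=; rewrite in_itv.
exact: measurable_funPTI.
Qed.

Lemma measurable_RV_lt y t : measurable [set w | y w < t].
Proof.
rewrite (_ : [set _ | _] = y @^-1` `]-oo, t[); last first.
  by apply/seteqP; split=> w /=; rewrite in_itv.
exact: measurable_funPTI.
Qed.

Lemma pr_setT : pr P setT = 1.
Proof. by rewrite /pr probability_setT. Qed.

Lemma RV_gtE y t : [set w | t < y w] = ~` [set w | y w <= t].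
Proof. by apply/seteqP; split=> w /=; rewrite ltNge => /negP. Qed.

Lemma measurable_RV_gt y t : measurable [set w | t < y w].
Proof. by rewrite RV_gtE; apply: measurableC; exact: measurable_RV_le. Qed.

Lemma pr_RV_gt y t : pr P [set w | t < y w] = 1 - pr P [set w | y w <= t].
Proof.
have my := measurable_RV_le y t.
by rewrite RV_gtE -setTD (ac_setD (pr_ac P))// pr_setT.
Qed.

Lemma cdfE y t : cdf y t = (pr P [set w | y w <= t])%:E.
Proof.
rewrite -prE; last exact: measurable_RV_le.
rewrite /cdf /distribution /= /pushforward; congr (P _).
Qed.

(** The infimum defining the quantile is attained, by right continuity of the
    distribution function; that 0 < a < 1 guarantees that it is a genuine
    infimum, over a nonempty set bounded below. *)
Lemma ginv_cdfP y a q : 0 < a < 1 ->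
  ginv (cdf y) a = q <->
  a <= pr P [set w | y w <= q] /\ forall t, t < q -> pr P [set w | y w <= t] < a.
Proof.
move=> /andP[a0 a1]; set S := [set t | (a%:E <= cdf y t)%E].
have SE t : S t <-> a <= pr P [set w | y w <= t] by rewrite /S /= cdfE lee_fin.
split=> [<-|[aq ltq]]; last first.
  apply/eqP; rewrite eq_le; apply/andP; split.
    apply: ge_inf; last exact/SE.
    by exists q => t /SE at_; rewrite leNgt; apply/negP => /ltq; rewrite ltNge at_.
  apply: lb_le_inf; first by exists q; exact/SE.
  by move=> t /SE at_; rewrite leNgt; apply/negP => /ltq; rewrite ltNge at_.
have nd s t : s <= t -> S s -> S t.
  by move=> st /le_trans; apply; exact: cdf_nondecreasing.
(* Otherwise P(y <= n) < a < 1 for all n, although these tend to 1. *)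
have S0 : S !=set0.
  apply/set0P/negP => /eqP S0.
  pose B n := [set w | y w <= n%:R].
  have ndB : nondecreasing_seq B.
    apply/nondecreasing_seqP => n; apply/subsetPset => w /le_trans; apply.
    by rewrite ler_nat.
  have := ac_cvg_bigcup (pr_ac P) (fun n => measurable_RV_le y n%:R) ndB.
  rewrite (_ : \bigcup_n _ = setT); last first.
    apply/seteqP; split=> // w _; exists (Num.truncn (y w)).+1 => //.
    exact/ltW/truncnS_gt.
  move=> /cvgr_to_le => /(_ a); rewrite pr_setT => h.
  suff : 1 <= a by rewrite leNgt a1.
  apply: h; apply: nearW => n; rewrite leNgt; apply/negP => /ltW/SE.
  by rewrite S0.
(* Otherwise P(y > -n) <= 1 - a < 1 for all n, although these tend to 1. *)
have Slb : has_lbound S.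
  apply: contrapT => nlb.
  pose B n := [set w | - n%:R < y w].
  have ndB : nondecreasing_seq B.
    apply/nondecreasing_seqP => n; apply/subsetPset => w; apply: le_lt_trans.
    by rewrite lerN2 ler_nat.
  have := ac_cvg_bigcup (pr_ac P) (fun n => measurable_RV_gt y (- n%:R)) ndB.
  rewrite (_ : \bigcup_n _ = setT); last first.
    apply/seteqP; split=> // w _; exists (Num.truncn (- y w)).+1 => //.
    by rewrite /B /= ltrNl; exact: truncnS_gt.
  move=> /cvgr_to_le => /(_ (1 - a)); rewrite pr_setT => h.
  suff : 1 <= 1 - a by lra.
  apply: h; apply: nearW => n; rewrite pr_RV_gt lerB//; apply/SE.
  apply: contrapT => nS; apply: nlb; exists (- n%:R) => t St.
  by rewrite leNgt; apply/negP => /ltW/nd/(_ St).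
rewrite /ginv -/S; split; last first.
  move=> t tinf; rewrite ltNge; apply/negP => /SE St.
  by move: tinf; rewrite ltNge => /negP; apply; exact: ge_inf.
(* P(y > i) is the limit of P(y > i + 1/(n+1)), each at most 1 - a. *)
pose i := inf S; pose B n := [set w | i + n.+1%:R^-1 < y w].
have n0 n : 0 < n.+1%:R^-1 :> R by rewrite invr_gt0.
have ndB : nondecreasing_seq B.
  apply/nondecreasing_seqP => n; apply/subsetPset => w; apply: le_lt_trans.
  by rewrite lerD2l lef_pV2 ?posrE// ler_nat.
have := ac_cvg_bigcup (pr_ac P) (fun n => measurable_RV_gt y (i + n.+1%:R^-1)) ndB.
rewrite (_ : \bigcup_n _ = [set w | i < y w]); last first.
  apply/seteqP; split=> w /=; first by move=> [n _]; apply: lt_trans; rewrite ltrDl.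
  rewrite -subr_gt0 => yi.
  have [n _ nP] := near_infty_natSinv_lt (PosNum yi).
  by exists n => //; have := nP n (leqnn n); rewrite /B /= ltrBrDl.
move=> /cvgr_to_le => /(_ (1 - a)) h.
suff : pr P [set w | i < y w] <= 1 - a by rewrite pr_RV_gt lerD2l lerN2.
apply: h; apply: nearW => n; rewrite pr_RV_gt lerD2l lerN2; apply/SE.
have [s Ss si] := inf_adherent (n0 n) (conj S0 Slb).
exact: nd (ltW si) Ss.
Qed.

Lemma pr_lt_le y a q :
  (forall t, t < q -> pr P [set w | y w <= t] < a) ->
  pr P [set w | y w < q] <= a.
Proof.
move=> ltq; pose B n := [set w | y w <= q - n.+1%:R^-1].
have n0 n : 0 < n.+1%:R^-1 :> R by rewrite invr_gt0.
have -> : [set w | y w < q] = \bigcup_n B n.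
  apply/seteqP; split=> w /=; last by move=> [n _ /le_lt_trans]; apply; rewrite ltrBlDr ltrDl.
  rewrite -subr_gt0 => yq.
  have [n _ nP] := near_infty_natSinv_lt (PosNum yq).
  by exists n => //; have := nP n (leqnn n); rewrite /B /= lerBrDr => /ltW; rewrite lerBrDl.
have mB n : measurable (B n) by exact: measurable_RV_le.
have ndB : nondecreasing_seq B.
  apply/nondecreasing_seqP => n; apply/subsetPset => w /le_trans; apply.
  by rewrite lerB// lef_pV2 ?posrE// ler_nat.
apply: (cvgr_to_le (ac_cvg_bigcup (pr_ac P) mB ndB)).
by apply: nearW => n; apply/ltW/ltq; rewrite ltrBlDr ltrDl.
Qed.

Lemma mixture_RV y1 y2 (K : set T) : measurable K ->
  exists y : {RV P >-> R}, forall w, y w = if w \in K then y1 w else y2 w.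
Proof.
move=> mK.
have my : measurable_fun setT (fun w => if w \in K then y1 w else y2 w).
  apply: measurable_fun_ifT => //.
  apply: (measurable_fun_bool true); rewrite setTI (_ : _ @^-1` _ = K)//.
  by apply/seteqP; split=> w /=; [move=> /set_mem|move=> /mem_set].
by exists (mfun_Sub (mem_set my)).
Qed.

End quantiles.

(** * Selections of a random interval *)

Section selections.
Context {d : measure_display} {T : measurableType d} {R : realType}.
Variables (P : probability T R) (Y : random_interval P).
Hypothesis Y_integrable :
  ('E_P[fun w => (`|lower Y w| + `|upper Y w|)%R] < +oo)%E.
Implicit Types (y : {RV P >-> R}) (a q t : R).

Lemma Sel_bounds y : Sel Y y ->
  {ae P, forall w, lower Y w <= y w <= upper Y w}.
Proof. by apply: filterS => w; rewrite /realization /= in_itv. Qed.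

Lemma le_expectation (f g : {RV P >-> R}) :
  P.-integrable setT (EFin \o f) -> P.-integrable setT (EFin \o g) ->
  {ae P, forall w, f w <= g w} -> ('E_P[f] <= 'E_P[g])%E.
Proof.
move=> intf intg fg; rewrite unlock integralE [leRHS]integralE.
have mf := measurable_int _ intf; have mg := measurable_int _ intg.
apply: leeB; apply: ae_ge0_le_integral => //.
- exact: measurable_funepos.
- exact: measurable_funepos.
- apply: filterS fg => w fg _.
  by rewrite !funeposE ge_max !le_max/= lee_fin fg lexx orbT.
- exact: measurable_funeneg.
- exact: measurable_funeneg.
- apply: filterS fg => w fg _.
  by rewrite !funenegE ge_max !le_max/= lee_fin lerN2 fg lexx orbT.
Qed.

Lemma integrable_dominated (f : {RV P >-> R}) :
  {ae P, forall w, `|f w| <= `|lower Y w| + `|upper Y w|} ->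
  P.-integrable setT (EFin \o f).
Proof.
move=> fLU; apply/integrableP; split; first exact/measurable_EFinP.
apply: le_lt_trans Y_integrable; rewrite unlock.
apply: ae_ge0_le_integral => //.
- by apply: measurableT_comp => //; exact/measurable_EFinP.
- apply/measurable_EFinP; apply: measurable_funD; exact: measurableT_comp.
by apply: filterS fLU => w fw _; rewrite /= lee_fin.
Qed.

Lemma integrable_Sel y : Sel Y y -> P.-integrable setT (EFin \o y).
Proof.
move=> /Sel_bounds yY; apply: integrable_dominated.
apply: filterS yY => w /andP[ly yu].
rewrite ler_norml; have := ler_norm (upper Y w); have := lerNnormlW (lexx `|lower Y w|).
have := normr_ge0 (upper Y w); have := normr_ge0 (lower Y w); lra.
Qed.

Lemma integrable_lower : P.-integrable setT (EFin \o lower Y).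
Proof.
apply: integrable_dominated; apply: nearW => w.
by rewrite lerDl.
Qed.

Lemma integrable_upper : P.-integrable setT (EFin \o upper Y).
Proof.
by apply: integrable_dominated; apply: nearW => w; rewrite lerDr.
Qed.

Lemma expectationE y : P.-integrable setT (EFin \o y) ->
  'E_P[y]%E = (\int[P]_w y w)%:E.
Proof. by move=> inty; rewrite unlock /Rintegral fineK// integrable_fin_num. Qed.

Lemma Sel_mixture y1 y2 y (K : set T) :
  (forall w, y w = if w \in K then y1 w else y2 w) ->
  Sel Y y1 -> Sel Y y2 -> Sel Y y.
Proof.
by move=> yE; rewrite /Sel /=; apply: filterS2 => w; rewrite yE; case: ifP.
Qed.

Lemma Rintegral_mixture (y1 y2 y : T -> R) (K : set T) : measurable K ->
  (forall w, y w = if w \in K then y1 w else y2 w) ->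
  P.-integrable setT (EFin \o y) ->
  \int[P]_w y w = \int[P]_(w in K) y1 w + \int[P]_(w in ~` K) y2 w.
Proof.
move=> mK yE inty; rewrite -[in LHS](setUv K) Rintegral_setU//; first last.
- exact/disj_set2P/setICr.
- by rewrite setUv.
- exact: measurableC.
congr (_ + _); apply: eq_Rintegral => w /set_mem Kw; rewrite yE.
  by rewrite mem_set.
by rewrite memNset.
Qed.

Lemma pr_mixture (y1 y2 y : T -> R) (K : set T) (p : pred R) : measurable K ->
  (forall w, y w = if w \in K then y1 w else y2 w) ->
  measurable [set w | p (y1 w)] -> measurable [set w | p (y2 w)] ->
  pr P [set w | p (y w)] =
  pr P (K `&` [set w | p (y1 w)]) + pr P (~` K `&` [set w | p (y2 w)]).
Proof.
move=> mK yE m1 m2.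
rewrite (_ : [set w | p (y w)] =
    (K `&` [set w | p (y1 w)]) `|` (~` K `&` [set w | p (y2 w)])).
  rewrite pr_setU//; [exact: measurableI| |].
    by apply: measurableI => //; exact: measurableC.
  by rewrite setIACA setICr set0I.
apply/seteqP; split=> w /=; rewrite yE.
  have [Kw|nK] := pselect (K w); first by rewrite mem_set//; left.
  by rewrite memNset//; right.
by move=> [[Kw]|[nK]]; [rewrite mem_set|rewrite memNset].
Qed.

End selections.

(** * Mixing selections with a prescribed quantile *)

Section main.
Context {d : measure_display} {T : measurableType d} {R : realType}.
Variables (P : probability T R) (Y : random_interval P) (a q : R).
Hypothesis P_nonatomic : nonatomic P.
Hypothesis Y_integrable :
  ('E_P[fun w => (`|lower Y w| + `|upper Y w|)%R] < +oo)%E.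
Hypothesis a01 : 0 < a < 1.
Implicit Types (y : {RV P >-> R}).

(** The finitely many set functions whose values on K decide the mean of the
    mixture of y1 and y2 along K and its masses on {<= q} and {< q}. *)
Definition profile y1 y2 : set (set T -> R) :=
  [set pr P;
     (fun A => \int[P]_(w in A) y1 w); (fun A => \int[P]_(w in A) y2 w);
     (fun A => pr P (A `&` [set w | y1 w <= q]));
     (fun A => pr P (A `&` [set w | y2 w <= q]));
     (fun A => pr P (A `&` [set w | y1 w < q]));
     (fun A => pr P (A `&` [set w | y2 w < q]))].

(** When P(y1 < q) = a, the set K has to meet the events {t < y1 < q} so that
    the mixture keeps mass just below q; these events form a nested family, and they
    have positive probability because P(y1 <= t) < a = P(y1 < q). *)
Lemma switching_set y1 y2 (s : R) :
  P.-integrable setT (EFin \o y1) -> P.-integrable setT (EFin \o y2) ->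
  ginv (cdf y1) a = q -> 0 < s < 1 ->
  exists K,
  [/\ measurable K,
    forall nu, profile y1 y2 nu -> nu K = s * nu setT,
    forall nu, profile y1 y2 nu -> nu (~` K) = (1 - s) * nu setT &
    pr P [set w | y1 w < q] = a ->
    forall t, t < q -> 0 < pr P (K `&` [set w | t < y1 w < q])].
Proof.
move=> int1 int2 /(ginv_cdfP _ _ a01)[_ lt1] s01.
set N := profile y1 y2.
have Nac nu : N nu -> ac_additive P nu.
  move=> [[[[[[->|->]|->]|->]|->]|->]|->]; try exact: pr_ac;
    try exact: ac_Rintegral; apply: ac_prI;
    try exact: measurable_RV_le; exact: measurable_RV_lt.
have halfN : halvable N.
  rewrite /N /profile; do 6!rewrite [_ `|` [set _]]setUC.
  do 6!(apply: halvable_setU1;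
    [by move=> nu Nnu; apply: Nac; move: Nnu; rewrite /N /profile /=; tauto
    |by rewrite /=; tauto
    |by apply: Nac; rewrite /N /profile /=; tauto
    |]).
  exact: nonatomic_halvable.
(* F is empty unless P(y1 < q) = a, since its members may be null otherwise. *)
pose F := [set C | pr P [set w | y1 w < q] = a /\
   exists2 t, t < q & C = [set w | t < y1 w < q]].
have FP C : F C -> measurable C /\ 0 < pr P C.
  move=> [y1a [t tq ->]].
  have -> : [set w | t < y1 w < q] = [set w | y1 w < q] `\` [set w | y1 w <= t].
    apply/seteqP; split=> w /=; first by move=> /andP[ty ->]; rewrite leNgt ty.
    by move=> [-> /negP]; rewrite -ltNge => ->.
  have me := measurable_RV_le y1 t; have ml := measurable_RV_lt y1 q.
  split; first exact: measurableD.
  rewrite (ac_setD (pr_ac P))//; last by move=> w /le_lt_trans; exact.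
  by rewrite y1a subr_gt0; exact: lt1.
have Ftot C C' : F C -> F C' -> C `<=` C' \/ C' `<=` C.
  move=> [_ [t tq ->]] [_ [t' tq' ->]].
  have [tt'|t't] := leP t t'; [right|left] => w /= /andP[ty ->]; rewrite andbT.
    exact: le_lt_trans ty.
  exact: lt_trans ty.
have [K [mK KE KF]] := halvable_share_meeting Nac halfN FP Ftot s01.
exists K; split=> //; last by move=> y1a t tq; apply: KF; split=> //; exists t.
move=> nu Nnu; have nuac := Nac _ Nnu.
by rewrite -setTD (ac_setD nuac)// KE// mulrBl mul1r.
Qed.

(** Admissible selections are mixed by switching between them along an event,
    not pointwise: a pointwise convex combination would in general lose the
    quantile. *)
Lemma Sel_quantile_mix y1 y2 (s : R) : Sel_quantile Y a q y1 ->
  Sel_quantile Y a q y2 -> 0 <= s <= 1 ->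
  exists2 y, Sel_quantile Y a q y &
    ('E_P[y] = s%:E * 'E_P[y1] + (1 - s)%:E * 'E_P[y2])%E.
Proof.
move=> S1 S2 /andP[s0 s1].
have [s0'|s_gt0] := leP s 0.
  have -> : s = 0 by lra.
  by exists y2 => //; rewrite mul0e add0e subr0 mul1e.
have [s1'|s_lt1] := leP 1 s.
  have -> : s = 1 by lra.
  by exists y1 => //; rewrite subrr mul0e adde0 mul1e.
have [Y1 Q1] := S1; have [Y2 Q2] := S2.
have int1 := integrable_Sel Y_integrable Y1.
have int2 := integrable_Sel Y_integrable Y2.
have s01 : 0 < s < 1 by rewrite s_gt0.
have [K [mK KE KcE KF]] := switching_set int1 int2 Q1 s01.
have [y yE] := mixture_RV y1 y2 mK.
have Yy := Sel_mixture yE Y1 Y2.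
have inty := integrable_Sel Y_integrable Yy.
have [q1 lt1] := (ginv_cdfP y1 q a01).1 Q1.
have [q2 lt2] := (ginv_cdfP y2 q a01).1 Q2.
have le_mix : pr P [set w | y w <= q] =
    s * pr P [set w | y1 w <= q] + (1 - s) * pr P [set w | y2 w <= q].
  rewrite (pr_mixture P (p := fun x => x <= q) mK yE); try exact: measurable_RV_le.
  rewrite (KE (fun A => pr P (A `&` [set w | y1 w <= q]))); last by rewrite /profile /=; tauto.
  rewrite (KcE (fun A => pr P (A `&` [set w | y2 w <= q]))); last by rewrite /profile /=; tauto.
  by rewrite !setTI.
have lt_mix : pr P [set w | y w < q] =
    s * pr P [set w | y1 w < q] + (1 - s) * pr P [set w | y2 w < q].
  rewrite (pr_mixture P (p := fun x => x < q) mK yE); try exact: measurable_RV_lt.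
  rewrite (KE (fun A => pr P (A `&` [set w | y1 w < q]))); last by rewrite /profile /=; tauto.
  rewrite (KcE (fun A => pr P (A `&` [set w | y2 w < q]))); last by rewrite /profile /=; tauto.
  by rewrite !setTI.
exists y; last first.
  rewrite !expectationE// -!EFinM -EFinD (Rintegral_mixture mK yE inty).
  rewrite (KE (fun A => \int[P]_(w in A) y1 w)); last by rewrite /profile /=; tauto.
  by rewrite (KcE (fun A => \int[P]_(w in A) y2 w)); last by rewrite /profile /=; tauto.
split=> //; apply/ginv_cdfP => //; split=> [|t tq].
  by rewrite le_mix; nra.
have l1 := pr_lt_le lt1; have l2 := pr_lt_le lt2.
have mt := measurable_RV_le y t; have mq := measurable_RV_lt y q.
have tq_sub : [set w | y w <= t] `<=` [set w | y w < q].
  by move=> w /= ywt; exact: le_lt_trans ywt tq.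
move: l1; rewrite le_eqVlt => /predU1P[l1a|l1a]; last first.
  by apply: le_lt_trans (le_pr P mt mq tq_sub) _; rewrite lt_mix; nra.
have mI : measurable (K `&` [set w | t < y1 w < q]).
  apply: measurableI => //.
  rewrite (_ : [set w | _] = [set w | t < y1 w] `&` [set w | y1 w < q]).
    by apply: measurableI; [exact: measurable_RV_gt|exact: measurable_RV_lt].
  by apply/seteqP; split=> w /=; [move=> /andP[]|move=> [-> ->]].
have KItq : K `&` [set w | t < y1 w < q] `<=` [set w | y w < q] `\` [set w | y w <= t].
  by move=> w [Kw /= /andP[ty yq]]; rewrite yE mem_set//; split=> //; rewrite leNgt ty.
(* The part of K where t < y1 < q separates P(y <= t) from P(y < q) <= a. *)
have := le_pr P mI (measurableD mq mt) KItq.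
have := KF l1a t tq.
rewrite (ac_setD (pr_ac P))// lt_mix; nra.
Qed.

End main.

Theorem proposition2p25 (d : measure_display) (T : measurableType d)
    (R : realType) (P : probability T R)
    (P_complete : measure_is_complete P) (P_nonatomic : nonatomic P)
    (Y : random_interval P)
    (Y_integrable :
      ('E_P[fun w => (`|lower Y w| + `|upper Y w|)%R] < +oo)%E)
    (a q : R) (a01 : 0 < a < 1)
    (q_range : ginv (capacity Y) a <= q <= ginv (containment Y) a) :
  [/\ convex_set (Theta_E Y a q : set (convex_lmodType R^o)),
      is_interval (Theta_E Y a q),
      Theta_E Y a q `<=`
        [set x : R | ('E_P[lower Y] <= x%:E <= 'E_P[upper Y])%E]
    & forall (y1 y2 : {RV P >-> R}) (theta : R),
        Sel_quantile Y a q y1 -> Sel_quantile Y a q y2 -> 0 <= theta <= 1 ->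
        exists2 y : {RV P >-> R}, Sel_quantile Y a q y &
          ('E_P[y] = theta%:E * 'E_P[y1] + (1 - theta)%:E * 'E_P[y2])%E].
Proof.
have mix := Sel_quantile_mix P_nonatomic Y_integrable a01.
have conv x z (s : R) : Theta_E Y a q x -> Theta_E Y a q z -> 0 <= s <= 1 ->
    Theta_E Y a q (s * x + (1 - s) * z).
  move=> [y1 S1 E1] [y2 S2 E2] s01; have [y Sy Ey] := mix _ _ _ _ S1 S2 s01.
  by exists y => //; rewrite Ey E1 E2.
split.
- move=> x z s /set_mem xT /set_mem zT; apply/mem_set.
  by apply: conv => //; apply/andP; split.
- move=> x z xT zT u /andP[xu uz].
  have [xz|zx] := ltP x z; last by have -> : u = x by lra.
  have zx0 : z - x != 0 by rewrite subr_eq0 gt_eqF.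
  have -> : u = (z - u) / (z - x) * x + (1 - (z - u) / (z - x)) * z by field.
  apply: conv => //; rewrite divr_ge0 ?ler_pdivrMr ?subr_ge0 ?subr_gt0 ?(ltW xz)//; lra.
- move=> x [y [Yy _] /= <-].
  have inty := integrable_Sel Y_integrable Yy.
  apply/andP; split; apply: le_expectation => //.
  + exact: integrable_lower.
  + by apply: filterS (Sel_bounds Yy) => w /andP[].
  + exact: integrable_upper.
  + by apply: filterS (Sel_bounds Yy) => w /andP[].
- by move=> y1 y2 s; exact: mix.
Qed.
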